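(* For any $\vdash C : T$, for all $\vdash c : T^* \rightarrow o$, $BT(C^*~c) = ET(C)[\mathtt{return}(V) \leftarrow BT(c~V^* )]$.
   Context: EPCF is a fine-grained call-by-value calculus with finite ground types $\mathsf{B}$ (with a set $\mathcal{V}$ of constant values), finite enumeration types $\mathsf{k}$ inhabited by $\underline{0},\dots,\underline{k-1}$, function types, fixpoints $\mathtt{fix}~x.V$, computations $V~W$, $\mathtt{return}(V)$, $\mathtt{let}~x = C~\mathtt{in}~B$, $\mathtt{case}(V;C_1,\dots,C_k)$ and algebraic operations $\sigma(V;x.C)$ with $\sigma : \mathsf{B} \rightsquigarrow k$ in a signature $\Sigma$. The effect tree $ET(C)$ of a closed computation $\vdash C : T$ is obtained by reducing $C$: it is $\bot$ if $C$ diverges, $\mathtt{return}(V)$ if $C \rightarrow^* \mathtt{return}(V)$, and $\sigma(v, ET(C[x:=\underline{0}]),\dots,ET(C[x:=\underline{k-1}]))$ if $C \rightarrow^* \sigma(v;x.C)$ (so the parameter is an extra first child). $BT(M)$ denotes the Böhm tree of a closed ground $\lambda Y$-term $M$ under weak head reduction, over the signature $\{v : 0 \mid v \in \mathcal{V}\} \cup \{\sigma : k+1 \mid (\sigma : \mathsf{B} \rightsquigarrow k) \in \Sigma\}$. The CPS translation $(\cdot)^*$ is: on types, with $\neg T = T \rightarrow o$, $\mathsf{B}^* = o$, $\mathsf{k}^* = \neg o^k$, $(T \rightarrow U)^* = T^* \rightarrow \neg U^* \rightarrow o$; on terms, $v^* = v$, $x^* = x$, $\underline{n}^* = \lambda x_0,\dots,x_{k-1}.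 x_n$, $(\lambda x.C)^* = \lambda x. C^*$, $(\mathtt{fix}~x.V)^* = Y(\lambda x.V^* )$, $(V~W)^* = \lambda c. V^*~W^*~c$, $\mathtt{return}(V)^* = \lambda c. c~V^*$, $\mathtt{case}(V;C_1,\dots,C_k)^* = \lambda c. V^*~(C_1~c)\cdots(C_k~c)$, $(\mathtt{let}~x = C~\mathtt{in}~B)^* = \lambda c. C^*~(\lambda x. B^*~c)$, $\sigma(V;x.C)^* = \lambda c. \sigma~V^*~(C^*[x:=\underline{0}^*]~c)\cdots(C^*[x:=\underline{k-1}^*]~c)$. The notation $t[\mathtt{return}(V) \leftarrow BT(c~V^* )]$ means replacing each leaf $\mathtt{return}(V)$ of $t$ by the tree $BT(c~V^* )$. *)

(* Defs.v *)
From mathcomp Require Import all_boot.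
From Stdlib Require Import Relations ClassicalEpsilon.

Set Implicit Arguments.
Unset Strict Implicit.
Unset Printing Implicit Defensive.

(* Ground types are finite: each has finitely many constants.  An operation [o]
   has arity [op_gty o ~> op_ar o]. Enumeration types and operations of size 0
   are allowed. *)
Record signature := Signature {
  gty : Type;
  const : Type;
  const_gty : const -> gty;
  const_fin : forall b, exists vs : seq const,
    forall v, const_gty v = b -> List.In v vs;
  op : Type;
  op_gty : op -> gty;
  op_ar : op -> nat }.

Section Calculi.

Variable S : signature.

Inductive ty : Type :=
| TGround (b : gty S)
| TEnum (k : nat)
| TArr (T U : ty).

(* De Bruijn indices.  [VLam C], [VFix V], the second argument of [CLet C B] and
   the continuation [C] of [COp o V C] bind index 0.  A numeral carries the
   enumeration type it belongs to, since its CPS translation depends on it. *)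
Inductive value : Type :=
| VVar (x : nat)
| VConst (v : const S)
| VEnum (k : nat) (n : 'I_k)
| VLam (C : computation)
| VFix (V : value)
with computation : Type :=
| CApp (V W : value)
| CRet (V : value)
| CLet (C B : computation)
| CCase (k : nat) (V : value) (Cs : 'I_k -> computation)
| COp (o : op S) (V : value) (C : computation).

Definition up_ren (r : nat -> nat) (x : nat) : nat :=
  if x is y.+1 then (r y).+1 else 0.

Fixpoint ren_val (r : nat -> nat) (V : value) : value :=
  match V with
  | VVar x => VVar (r x)
  | VConst v => VConst v
  | VEnum k n => VEnum n
  | VLam C => VLam (ren_comp (up_ren r) C)
  | VFix V => VFix (ren_val (up_ren r) V)
  end
with ren_comp (r : nat -> nat) (C : computation) : computation :=
  match C with
  | CApp V W => CApp (ren_val r V) (ren_val r W)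
  | CRet V => CRet (ren_val r V)
  | CLet C B => CLet (ren_comp r C) (ren_comp (up_ren r) B)
  | CCase k V Cs => CCase (ren_val r V) (fun i => ren_comp r (Cs i))
  | COp o V C => COp o (ren_val r V) (ren_comp (up_ren r) C)
  end.

Definition up_val (s : nat -> value) (x : nat) : value :=
  if x is y.+1 then ren_val succn (s y) else VVar 0.

Fixpoint subst_val (s : nat -> value) (V : value) : value :=
  match V with
  | VVar x => s x
  | VConst v => VConst v
  | VEnum k n => VEnum n
  | VLam C => VLam (subst_comp (up_val s) C)
  | VFix V => VFix (subst_val (up_val s) V)
  end
with subst_comp (s : nat -> value) (C : computation) : computation :=
  match C with
  | CApp V W => CApp (subst_val s V) (subst_val s W)
  | CRet V => CRet (subst_val s V)
  | CLet C B => CLet (subst_comp s C) (subst_comp (up_val s) B)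
  | CCase k V Cs => CCase (subst_val s V) (fun i => subst_comp s (Cs i))
  | COp o V C => COp o (subst_val s V) (subst_comp (up_val s) C)
  end.

Definition inst_val (W : value) (x : nat) : value :=
  if x is y.+1 then VVar y else W.

(* Fixpoints are values of function type only: otherwise closed values of ground
   type would not all be constants. *)
Inductive has_ty_val : seq ty -> value -> ty -> Prop :=
| has_ty_var G x T : onth G x = Some T -> has_ty_val G (VVar x) T
| has_ty_const G v : has_ty_val G (VConst v) (TGround (const_gty v))
| has_ty_enum G k (n : 'I_k) : has_ty_val G (VEnum n) (TEnum k)
| has_ty_lam G C T U :
    has_ty_comp (T :: G) C U -> has_ty_val G (VLam C) (TArr T U)
| has_ty_fix G V T U :
    has_ty_val (TArr T U :: G) V (TArr T U) -> has_ty_val G (VFix V) (TArr T U)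
with has_ty_comp : seq ty -> computation -> ty -> Prop :=
| has_ty_app G V W T U :
    has_ty_val G V (TArr T U) -> has_ty_val G W T -> has_ty_comp G (CApp V W) U
| has_ty_ret G V T : has_ty_val G V T -> has_ty_comp G (CRet V) T
| has_ty_let G C B T U :
    has_ty_comp G C T -> has_ty_comp (T :: G) B U -> has_ty_comp G (CLet C B) U
| has_ty_case G k V (Cs : 'I_k -> computation) T :
    has_ty_val G V (TEnum k) -> (forall i, has_ty_comp G (Cs i) T) ->
    has_ty_comp G (CCase V Cs) T
| has_ty_op G o V C T :
    has_ty_val G V (TGround (op_gty o)) ->
    has_ty_comp (TEnum (op_ar o) :: G) C T ->
    has_ty_comp G (COp o V C) T.

Inductive step : computation -> computation -> Prop :=
| step_beta C V : step (CApp (VLam C) V) (subst_comp (inst_val V) C)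
| step_fix V W :
    step (CApp (VFix V) W) (CApp (subst_val (inst_val (VFix V)) V) W)
| step_ret V B : step (CLet (CRet V) B) (subst_comp (inst_val V) B)
| step_case k (n : 'I_k) Cs : step (CCase (VEnum n) Cs) (Cs n)
| step_let C C' B : step C C' -> step (CLet C B) (CLet C' B)
| step_op o V C B :
    step (CLet (COp o V C) B) (COp o V (CLet C (ren_comp (up_ren succn) B))).

Definition steps : computation -> computation -> Prop :=
  clos_refl_trans_1n computation step.

Inductive symbol : Type :=
| SConst (v : const S)
| SOp (o : op S).

Definition arity (a : symbol) : nat :=
  match a with
  | SConst _ => 0
  | SOp o => (op_ar o).+1
  end.

Inductive lty : Type :=
| LO
| LArr (A B : lty).

Definition lneg (A : lty) : lty := LArr A LO.

Definition lpow_arr (n : nat) : lty := iter n (LArr LO) LO.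

Inductive tm : Type :=
| Var (x : nat)
| Sym (a : symbol)
| Y
| Lam (M : tm)
| App (M N : tm).

Definition apps (M : tm) (Ns : seq tm) : tm := foldl App M Ns.

Fixpoint ren (r : nat -> nat) (M : tm) : tm :=
  match M with
  | Var x => Var (r x)
  | Sym a => Sym a
  | Y => Y
  | Lam M => Lam (ren (up_ren r) M)
  | App M N => App (ren r M) (ren r N)
  end.

Definition up (s : nat -> tm) (x : nat) : tm :=
  if x is y.+1 then ren succn (s y) else Var 0.

Fixpoint subst (s : nat -> tm) (M : tm) : tm :=
  match M with
  | Var x => s x
  | Sym a => Sym a
  | Y => Y
  | Lam M => Lam (subst (up s) M)
  | App M N => App (subst s M) (subst s N)
  end.

Definition inst (N : tm) (x : nat) : tm := if x is y.+1 then Var y else N.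

Inductive has_lty : seq lty -> tm -> lty -> Prop :=
| has_lty_var G x A : onth G x = Some A -> has_lty G (Var x) A
| has_lty_sym G a : has_lty G (Sym a) (lpow_arr (arity a))
| has_lty_Y G A : has_lty G Y (LArr (LArr A A) A)
| has_lty_lam G M A B : has_lty (A :: G) M B -> has_lty G (Lam M) (LArr A B)
| has_lty_app G M N A B :
    has_lty G M (LArr A B) -> has_lty G N A -> has_lty G (App M N) B.

Inductive whstep : tm -> tm -> Prop :=
| whstep_beta M N : whstep (App (Lam M) N) (subst (inst N) M)
| whstep_Y M : whstep (App Y M) (App M (App Y M))
| whstep_app M M' N : whstep M M' -> whstep (App M N) (App M' N).

Definition whsteps : tm -> tm -> Prop := clos_refl_trans_1n tm whstep.

(* Possibly infinite ranked trees over [symbol], with [TBot] of arity 0 and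
   additional leaves labelled in [X]. *)
CoInductive tree (X : Type) : Type :=
| TBot
| TLeaf (x : X)
| TNode (a : symbol) (ts : 'I_(arity a) -> tree X).

Arguments TBot {X}.

(* Equality of infinite trees is bisimilarity, since Leibniz equality of
   coinductive terms is not extensional. *)
CoInductive tree_eq (X : Type) : tree X -> tree X -> Prop :=
| tree_eq_bot : tree_eq TBot TBot
| tree_eq_leaf x : tree_eq (TLeaf x) (TLeaf x)
| tree_eq_node a (ts us : 'I_(arity a) -> tree X) :
    (forall i, tree_eq (ts i) (us i)) -> tree_eq (TNode ts) (TNode us).

(* [t[x <- f x]]; the inner [match] only serves the guard condition. *)
CoFixpoint graft (X Z : Type) (t : tree X) (f : X -> tree Z) : tree Z :=
  match t with
  | TBot => TBot
  | TLeaf x =>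
      match f x with
      | TBot => TBot
      | TLeaf z => TLeaf z
      | TNode a ts => TNode ts
      end
  | TNode a ts => TNode (fun i => graft (ts i) f)
  end.

Definition const_tree (X : Type) (v : const S) : tree X :=
  @TNode X (SConst v) (fun i => match notF (ltn_ord i) with end).

(* Some chosen witness of [P], or [None] if there is none. *)
Definition find_some (A : Type) (P : A -> Prop) : option A :=
  match excluded_middle_informative (exists x, P x) with
  | left h => Some (proj1_sig (constructive_indefinite_description P h))
  | right _ => None
  end.

Inductive result : Type :=
| RRet (V : value)
| ROp (o : op S) (v : const S) (C : computation).

Definition comp_of_result (r : result) : computation :=
  match r with
  | RRet V => CRet V
  | ROp o v C => COp o (VConst v) C
  end.

(* Reduction is deterministic, so the choice made by [find_some] is immaterial;
   a closed well-typed computation that reaches no result diverges. *)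
CoFixpoint ET (C : computation) : tree value :=
  match find_some (fun r => steps C (comp_of_result r)) with
  | None => TBot
  | Some (RRet V) => TLeaf V
  | Some (ROp o v C') =>
      @TNode value (SOp o) (fun i : 'I_(op_ar o).+1 =>
        match unlift ord0 i with
        | None => const_tree value v
        | Some j => ET (subst_comp (inst_val (VEnum j)) C')
        end)
  end.

CoFixpoint BT (M : tm) : tree void :=
  match find_some (fun p : {a : symbol & (arity a).-tuple tm} =>
                     whsteps M (apps (Sym (tag p)) (tagged p))) with
  | None => TBot
  | Some (existT a Ns) => TNode (fun i => BT (tnth Ns i))
  end.

Fixpoint cps_ty (T : ty) : lty :=
  match T with
  | TGround _ => LO
  | TEnum k => lpow_arr k
  | TArr T U => LArr (cps_ty T) (LArr (lneg (cps_ty U)) LO)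
  end.

Definition cps_enum (k : nat) (n : 'I_k) : tm :=
  iter k Lam (Var (rev_ord n)).

(* The continuation variable [c] introduced by a translated computation is
   index 0, so the translated subterms are renamed past it; in the [CLet] case
   the translation of [B] moves from the context [G, x] to [G, c, x]. *)
Fixpoint cps_val (V : value) : tm :=
  match V with
  | VVar x => Var x
  | VConst v => Sym (SConst v)
  | VEnum k n => cps_enum n
  | VLam C => Lam (cps_comp C)
  | VFix V => App Y (Lam (cps_val V))
  end
with cps_comp (C : computation) : tm :=
  match C with
  | CApp V W =>
      Lam (apps (ren succn (cps_val V)) [:: ren succn (cps_val W); Var 0])
  | CRet V => Lam (App (Var 0) (ren succn (cps_val V)))
  | CLet C B =>
      Lam (App (ren succn (cps_comp C))
               (Lam (App (ren (up_ren succn) (cps_comp B)) (Var 1))))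
  | CCase k V Cs =>
      Lam (apps (ren succn (cps_val V))
                [seq App (ren succn (cps_comp (Cs i))) (Var 0) | i <- enum 'I_k])
  | COp o V C =>
      Lam (apps (Sym (SOp o))
             (ren succn (cps_val V) ::
              [seq App (ren succn (subst (inst (cps_enum i)) (cps_comp C)))
                       (Var 0)
              | i <- enum 'I_(op_ar o)]))
  end.

End Calculi.

(* Main.v *)
(** Every source step [C -> C'] is simulated by the translation: for each
    continuation [K], the terms [C* K] and [C'* K] reduce by weak head steps to
    the same term, or to nodes with the same symbol whose children agree up to
    weak head reduction (this happens when an operation is pulled out of a
    [let]).  Hence [BT (C* K)] is invariant under reduction of [C], and the
    theorem follows by coinduction once [C] reaches a result.  As [C'* K] needs
    strictly fewer steps than [C* K] to reach a head symbol, and closed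
    well-typed computations do not get stuck, [C] reaches a result whenever
    [C* K] has a head symbol; so divergence is preserved without any
    termination argument on the target calculus. *)

Require Import Defs.
From mathcomp Require Import all_boot.
From Stdlib Require Import Relations ClassicalEpsilon.

Set Implicit Arguments.
Unset Strict Implicit.
Unset Printing Implicit Defensive.

(** * Renaming and substitution algebra of the target calculus *)

Section Substitution.

Variable S : signature.
Implicit Types (M N : tm S) (s : nat -> tm S) (r : nat -> nat).

Lemma ren_ext r1 r2 M : r1 =1 r2 -> ren r1 M = ren r2 M.
Proof.
elim: M r1 r2 => [x|a||M IH|M IHM N IHN] r1 r2 e //=.
- by rewrite e.
- by congr Lam; apply: IH => -[|x] //=; rewrite e.
- by rewrite (IHM _ _ e) (IHN _ _ e).
Qed.

Lemma subst_ext s1 s2 M : s1 =1 s2 -> subst s1 M = subst s2 M.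
Proof.
elim: M s1 s2 => [x|a||M IH|M IHM N IHN] s1 s2 e //=.
- by congr Lam; apply: IH => -[|x] //=; rewrite e.
- by rewrite (IHM _ _ e) (IHN _ _ e).
Qed.

Lemma ren_ren r1 r2 M : ren r2 (ren r1 M) = ren (r2 \o r1) M.
Proof.
elim: M r1 r2 => [x|a||M IH|M IHM N IHN] r1 r2 //=.
- by rewrite IH; congr Lam; apply: ren_ext => -[|x].
- by rewrite IHM IHN.
Qed.

Lemma subst_ren r s M : subst s (ren r M) = subst (s \o r) M.
Proof.
elim: M r s => [x|a||M IH|M IHM N IHN] r s //=.
- by rewrite IH; congr Lam; apply: subst_ext => -[|x].
- by rewrite IHM IHN.
Qed.

Lemma ren_subst r s M : ren r (subst s M) = subst (ren r \o s) M.
Proof.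
elim: M r s => [x|a||M IH|M IHM N IHN] r s //=.
- rewrite IH; congr Lam; apply: subst_ext => -[|x] //=.
  by rewrite !ren_ren.
- by rewrite IHM IHN.
Qed.

Lemma subst_up_ren s M : subst (up s) (ren succn M) = ren succn (subst s M).
Proof. by rewrite subst_ren ren_subst. Qed.

Lemma subst_subst s1 s2 M : subst s2 (subst s1 M) = subst (subst s2 \o s1) M.
Proof.
elim: M s1 s2 => [x|a||M IH|M IHM N IHN] s1 s2 //=.
- rewrite IH; congr Lam; apply: subst_ext => -[|x] //=.
  by rewrite subst_up_ren.
- by rewrite IHM IHN.
Qed.

Lemma subst_Var M : subst (@Var S) M = M.
Proof.
elim: M => [x|a||M IH|M IHM N IHN] //=.
- by congr Lam; rewrite -[RHS]IH; apply: subst_ext => -[|x].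
- by rewrite IHM IHN.
Qed.

Lemma ren_as_subst r M : ren r M = subst (@Var S \o r) M.
Proof. by rewrite -[LHS]subst_Var subst_ren. Qed.

Lemma subst_inst_ren N M : subst (inst N) (ren succn M) = M.
Proof. by rewrite subst_ren -[RHS]subst_Var; apply: subst_ext => x. Qed.

Lemma subst_apps s M Ns : subst s (apps M Ns) = apps (subst s M) (map (subst s) Ns).
Proof. by elim: Ns M => //= N Ns IH M; rewrite IH. Qed.

Lemma ren_apps r M Ns : ren r (apps M Ns) = apps (ren r M) (map (ren r) Ns).
Proof. by elim: Ns M => //= N Ns IH M; rewrite IH. Qed.

Lemma subst_iter_Lam k s M :
  subst s (iter k (@Lam S) M) = iter k (@Lam S) (subst (iter k (@up S) s) M).
Proof. by elim: k s => //= k IH s; rewrite IH -[up (iter k _ s)]/(iter k.+1 _ s) iterSr. Qed.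

Lemma iter_up_lt k s x : x < k -> iter k (@up S) s x = Var S x.
Proof. by elim: k s x => //= k IH s [|x] //= lt_xk; rewrite IH. Qed.

Lemma iter_up_add k s x : iter k (@up S) s (k + x) = ren (addn k) (s x).
Proof.
elim: k => [|k IH] /=; last by rewrite IH ren_ren; apply: ren_ext.
by rewrite ren_as_subst -[LHS]subst_Var; apply: subst_ext.
Qed.

(** The only variable of a numeral has index [rev_ord n < k] and is bound by its own [k]
    abstractions, so the numeral is closed. *)
Lemma subst_cps_enum s k (n : 'I_k) : subst s (cps_enum S n) = cps_enum S n.
Proof.
rewrite /cps_enum subst_iter_Lam; congr (iter k _ _).
exact: iter_up_lt (ltn_ord (rev_ord n)).
Qed.

Lemma ren_cps_enum r k (n : 'I_k) : ren r (cps_enum S n) = cps_enum S n.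
Proof. by rewrite ren_as_subst subst_cps_enum. Qed.

(** The clause of the translation for operations itself substitutes numerals; closedness of numerals
    lets an outer substitution pass through it. *)
Lemma subst_inst_cps_enum s k (n : 'I_k) M :
  subst s (subst (inst (cps_enum S n)) M) =
  subst (inst (cps_enum S n)) (subst (up s) M).
Proof.
rewrite !subst_subst; apply: subst_ext => -[|x] /=.
  by rewrite subst_cps_enum.
by rewrite subst_inst_ren.
Qed.

Lemma ren_inst_cps_enum r k (n : 'I_k) M :
  ren r (subst (inst (cps_enum S n)) M) =
  subst (inst (cps_enum S n)) (ren (up_ren r) M).
Proof.
rewrite ren_subst subst_ren; apply: subst_ext => -[|x] //=.
by rewrite ren_cps_enum.
Qed.

End Substitution.

Scheme value_mutind := Induction for value Sort Prop
with computation_mutind := Induction for computation Sort Prop.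
Combined Scheme value_computation_ind from value_mutind, computation_mutind.

Scheme has_ty_val_mutind := Minimality for has_ty_val Sort Prop
with has_ty_comp_mutind := Minimality for has_ty_comp Sort Prop.
Combined Scheme has_ty_ind from has_ty_val_mutind, has_ty_comp_mutind.

(** * Compatibility of the CPS translation with renaming and substitution *)

Section CpsSubstitution.

Variable S : signature.

Lemma cps_ren :
  (forall (V : value S) r, cps_val (ren_val r V) = ren r (cps_val V)) /\
  (forall (C : computation S) r, cps_comp (ren_comp r C) = ren r (cps_comp C)).
Proof.
have up_succ r (M : tm S) : ren (up_ren r) (ren succn M) = ren succn (ren r M).
  by rewrite !ren_ren.
apply value_computation_ind; rewrite //=.
- by move=> k n r; rewrite ren_cps_enum.
- by move=> C IH r; rewrite IH.
- by move=> V IH r; rewrite IH.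
- by move=> V IHV W IHW r; rewrite IHV IHW !up_succ.
- by move=> V IH r; rewrite IH up_succ.
- move=> C IHC B IHB r; rewrite IHC IHB up_succ !ren_ren.
  (* Making room for the continuation at index 1 commutes with [r], which acts above the two bound
     indices. *)
  by congr (Lam (App _ (Lam (App _ _)))); apply: ren_ext => -[|x].
- move=> k V IHV Cs IHCs r; rewrite ren_apps IHV up_succ -map_comp.
  by congr (Lam (apps _ _)); apply: eq_map => i /=; rewrite IHCs up_succ.
- move=> o V IHV C IHC r; rewrite ren_apps /= IHV up_succ -map_comp.
  congr (Lam (apps _ (_ :: _))); apply: eq_map => i /=.
  by rewrite IHC up_succ [in RHS]ren_inst_cps_enum.
Qed.

Lemma cps_subst :
  (forall (V : value S) s,
    cps_val (subst_val s V) = subst (fun x => cps_val (s x)) (cps_val V)) /\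
  (forall (C : computation S) s,
    cps_comp (subst_comp s C) = subst (fun x => cps_val (s x)) (cps_comp C)).
Proof.
have cps_up (s : nat -> value S) M :
  subst (fun x => cps_val (up_val s x)) M = subst (up (fun x => cps_val (s x))) M.
  by apply: subst_ext => -[|x] //=; rewrite cps_ren.1.
apply value_computation_ind; rewrite //=.
- by move=> k n s; rewrite subst_cps_enum.
- by move=> C IH s; rewrite IH cps_up.
- by move=> V IH s; rewrite IH cps_up.
- by move=> V IHV W IHW s; rewrite IHV IHW !subst_up_ren.
- by move=> V IH s; rewrite IH subst_up_ren.
- move=> C IHC B IHB s; rewrite IHC IHB cps_up subst_up_ren.
  congr (Lam (App _ (Lam (App _ _)))).
  rewrite subst_ren ren_subst; apply: subst_ext => -[|x] //=.
  by rewrite !ren_ren.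
- move=> k V IHV Cs IHCs s; rewrite subst_apps IHV subst_up_ren -map_comp.
  by congr (Lam (apps _ _)); apply: eq_map => i /=; rewrite IHCs subst_up_ren.
- move=> o V IHV C IHC s; rewrite subst_apps /= IHV subst_up_ren -map_comp.
  congr (Lam (apps _ (_ :: _))); apply: eq_map => i /=.
  by rewrite IHC cps_up subst_up_ren subst_inst_cps_enum.
Qed.

Lemma cps_inst_comp V (C : computation S) :
  cps_comp (subst_comp (inst_val V) C) = subst (inst (cps_val V)) (cps_comp C).
Proof. by rewrite cps_subst.2; apply: subst_ext => -[|x]. Qed.

Lemma cps_inst_val V (W : value S) :
  cps_val (subst_val (inst_val V) W) = subst (inst (cps_val V)) (cps_val W).
Proof. by rewrite cps_subst.1; apply: subst_ext => -[|x]. Qed.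

End CpsSubstitution.

(** * Preservation and progress for EPCF *)

Section Typing.

Variable S : signature.
Implicit Types (G D : seq (ty S)) (V : value S) (C : computation S).

Lemma ren_typing :
  (forall G V T, has_ty_val G V T -> forall D r,
    (forall x A, onth G x = Some A -> onth D (r x) = Some A) ->
    has_ty_val D (ren_val r V) T) /\
  (forall G C T, has_ty_comp G C T -> forall D r,
    (forall x A, onth G x = Some A -> onth D (r x) = Some A) ->
    has_ty_comp D (ren_comp r C) T).
Proof.
have up_ok G D r (T : ty S) :
    (forall x A, onth G x = Some A -> onth D (r x) = Some A) ->
  forall x A, onth (T :: G) x = Some A -> onth (T :: D) (up_ren r x) = Some A.
  by move=> ok [|x] A //=; apply: ok.
apply has_ty_ind; rewrite /=; intros; econstructor; eauto.
Qed.

Lemma subst_typing :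
  (forall G V T, has_ty_val G V T -> forall D s,
    (forall x A, onth G x = Some A -> has_ty_val D (s x) A) ->
    has_ty_val D (subst_val s V) T) /\
  (forall G C T, has_ty_comp G C T -> forall D s,
    (forall x A, onth G x = Some A -> has_ty_val D (s x) A) ->
    has_ty_comp D (subst_comp s C) T).
Proof.
have up_ok G D s (T : ty S) :
    (forall x A, onth G x = Some A -> has_ty_val D (s x) A) ->
  forall x A, onth (T :: G) x = Some A -> has_ty_val (T :: D) (up_val s x) A.
  move=> ok [|x] A /= eA; first by constructor.
  by apply: ren_typing.1 (ok _ _ eA) _ _ _.
apply has_ty_ind; rewrite /=; first by eauto.
all: by move=> *; econstructor; eauto.
Qed.

Lemma inst_typing G V (T : ty S) :
  has_ty_val G V T ->
  forall x A, onth (T :: G) x = Some A -> has_ty_val G (inst_val V x) A.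
Proof. by move=> tyV [|x] A /= => [[<-] //|eA]; constructor. Qed.

Lemma val_typing_inv G V (T : ty S) : has_ty_val G V T ->
  match V with
  | VLam C => exists A B, T = TArr A B /\ has_ty_comp (A :: G) C B
  | VFix W => exists A B, T = TArr A B /\ has_ty_val (TArr A B :: G) W (TArr A B)
  | _ => True
  end.
Proof. by case=> * //; do 2 eexists. Qed.

(** Phrasing inversion as a match on [C] avoids equations between branch families indexed by the
    arity [k] of a case. *)
Lemma comp_typing_inv G C (T : ty S) : has_ty_comp G C T ->
  match C with
  | CApp V W => exists A, has_ty_val G V (TArr A T) /\ has_ty_val G W A
  | CRet V => has_ty_val G V T
  | CLet C B => exists A, has_ty_comp G C A /\ has_ty_comp (A :: G) B T
  | @CCase _ k V Cs =>
      has_ty_val G V (TEnum S k) /\ forall i, has_ty_comp G (Cs i) T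
  | COp o V C => has_ty_val G V (TGround (op_gty o)) /\
      has_ty_comp (TEnum S (op_ar o) :: G) C T
  end.
Proof. by case=> * //; eexists; eauto. Qed.

Lemma preservation C C' : step C C' ->
  forall G (T : ty S), has_ty_comp G C T -> has_ty_comp G C' T.
Proof.
elim=> {C C'} [C V|V W|V B|k n Cs|C C' B _ IH|o V C B] G T /comp_typing_inv.
- case=> A [/val_typing_inv [A' [B' [[-> ->] tyC]]] tyV].
  exact: subst_typing.2 tyC _ _ (inst_typing tyV).
- case=> A [tyF tyW].
  have [A' [B' [e tyV]]] := val_typing_inv tyF; case: e tyV => <- <- tyV.
  by apply: has_ty_app tyW; apply: subst_typing.1 tyV _ _ (inst_typing tyF).
- case=> A [/comp_typing_inv tyV tyB].
  exact: subst_typing.2 tyB _ _ (inst_typing tyV).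
- by case.
- by case=> A [tyC tyB]; apply: has_ty_let tyB; apply: IH.
- case=> A [/comp_typing_inv [tyV tyC] tyB].
  apply: has_ty_op => //; apply: has_ty_let tyC _.
  by apply: ren_typing.2 tyB _ _ _ => -[|x].
Qed.

Lemma steps_preservation C C' : steps C C' ->
  forall G (T : ty S), has_ty_comp G C T -> has_ty_comp G C' T.
Proof.
by elim=> // C1 C2 C3 st _ IH G T ty1; apply: IH; apply: preservation st _ _ _.
Qed.

(** The empty context excludes variables, and fixpoints have arrow types only, so the parameter of a
    closed operation is a constant. *)
Lemma canonical_forms V (T : ty S) : has_ty_val [::] V T ->
  match T with
  | TGround _ => exists v, V = VConst v
  | TEnum k => exists n : 'I_k, V = VEnum S n
  | TArr _ _ => (exists C, V = VLam C) \/ (exists W, V = VFix W)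
  end.
Proof.
move eG: [::] => G tyV; case: G V T / tyV eG => [G x A|G v|G k n|G C A B _|G W A B _].
- by move=> eA eG; move: eA; rewrite -eG; case: x.
- by exists v.
- by exists n.
- by left; exists C.
- by right; exists W.
Qed.

(** An operation under a [let] is not stuck, since [step_op] pulls it out; canonical forms settle
    applications and cases. *)
Lemma progress C (T : ty S) : has_ty_comp [::] C T ->
  (exists r, C = comp_of_result r) \/ (exists C', step C C').
Proof.
elim: C T => [V W|V|C IHC B _|k V Cs _|o V C _] T /comp_typing_inv.
- move=> [A [/canonical_forms[[C ->]|[F ->]] _]]; right; eexists; constructor.
- by left; exists (RRet V).
- move=> [A [/IHC[[[W|o v D] ->]|[C' st]] _]]; right; eexists;
    constructor; eassumption.
- by move=> [/canonical_forms[n ->] _]; right; eexists; constructor.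
- by move=> [/canonical_forms[v ->] _]; left; exists (ROp o v C).
Qed.

End Typing.

(** * Counted weak head reduction, Böhm trees and bisimilarity *)

Section WeakHead.

Variable S : signature.
Implicit Types (M N P K : tm S).

Inductive whn : nat -> tm S -> tm S -> Prop :=
| whn0 M : whn 0 M M
| whnS n M N P : whstep M N -> whn n N P -> whn n.+1 M P.

Lemma whn_trans m n M N P : whn m M N -> whn n N P -> whn (m + n) M P.
Proof. by elim=> // l A B D st _ IH /IH; rewrite addSn; apply: whnS. Qed.

Lemma whstepsP M N : whsteps M N <-> exists n, whn n M N.
Proof.
split; first by elim=> [P|A B D st _ [n IH]]; eexists; econstructor; eauto.
by case=> n; elim=> [P|l A B D st _ IH]; econstructor; eauto.
Qed.

Lemma whn_apps n M N Ns : whn n M N -> whn n (apps M Ns) (apps N Ns).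
Proof.
elim: Ns M N => //= A Ns IH M N w; apply: IH.
by elim: w => [P|l B D P st _ IHw]; econstructor; eauto; constructor.
Qed.

Lemma apps_rcons M Ns N : apps M (rcons Ns N) = App (apps M Ns) N.
Proof. by rewrite /apps foldl_rcons. Qed.

(** The head of the spine is neither an abstraction nor [Y]; induction from the last argument
    exposes the outermost application. *)
Lemma apps_Sym_normal a Ns M : ~ whstep (apps (Sym a) Ns) M.
Proof.
elim/last_ind: Ns M => [|Ns N IH] M; first by move=> st; inversion st.
rewrite apps_rcons => st; inversion st; subst.
- by case/lastP: Ns H0 {IH st} => [|Ns' N'] //; rewrite apps_rcons.
- by case/lastP: Ns H0 {IH st} => [|Ns' N'] //; rewrite apps_rcons.
- by apply: IH H2.
Qed.

Lemma whstep_det M N P : whstep M N -> whstep M P -> N = P.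
Proof.
move=> st; elim: st P => {M N} [M N|M|M M' N st IH] P st'.
- inversion st' => //; subst; match goal with H : whstep (Lam _) _ |- _ => inversion H end.
- inversion st' => //; subst; match goal with H : whstep (Y _) _ |- _ => inversion H end.
- inversion st'; subst; try by inversion st.
  by congr App; apply: IH.
Qed.

Lemma apps_Sym_inj a b Ns Ms : apps (@Sym S a) Ns = apps (Sym b) Ms -> a = b /\ Ns = Ms.
Proof.
elim/last_ind: Ns Ms => [|Ns N IH] Ms; case/lastP: Ms => [|Ms M];
  rewrite ?apps_rcons //=; first by case.
by case=> /IH[-> ->] ->.
Qed.

(** By determinism every reduct of [M] lies on its unique path to the normal form, so the step
    counts subtract. *)
Lemma whn_to_normal m n M N a Ns :
  whn m M N -> whn n M (apps (Sym a) Ns) ->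
  m <= n /\ whn (n - m) N (apps (Sym a) Ns).
Proof.
move=> w; elim: w n => [{}M n|{}m {}M N' P st _ IH n] w'.
  by rewrite subn0.
inversion w' as [M' e1 e2 e3|n' M' N'' P' st' w'' e1 e2 e3]; subst.
  by case: (apps_Sym_normal st).
by have [] := IH n'; rewrite ?subSS // (whstep_det st st').
Qed.

Lemma tree_unfold X (t : tree S X) :
  t = match t with TBot => TBot S X | TLeaf x => TLeaf S x | TNode a ts => TNode ts end.
Proof. by case: t. Qed.

Lemma BTE M : BT M =
  match find_some (fun p : {a : symbol S & (arity a).-tuple (tm S)} =>
                     whsteps M (apps (Sym (tag p)) (tagged p))) with
  | None => TBot S void
  | Some (existT a Ns) => TNode (fun i => BT (tnth Ns i))
  end.
Proof.
rewrite [LHS]tree_unfold /=.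
by case: find_some => [[a Ns]|].
Qed.

Lemma find_someP A (P : A -> Prop) :
  match find_some P with Some x => P x | None => ~ exists x, P x end.
Proof.
rewrite /find_some; case: excluded_middle_informative => // h /=.
exact: proj2_sig.
Qed.

(** Determinism and normality of symbol-headed spines make the spine chosen by [find_some] the given
    one. *)
Lemma BT_node M a (Ns : (arity a).-tuple (tm S)) :
  whsteps M (apps (Sym a) Ns) -> BT M = TNode (fun i => BT (tnth Ns i)).
Proof.
move=> w; rewrite BTE; have := find_someP
  (fun p : {a : symbol S & (arity a).-tuple (tm S)} =>
     whsteps M (apps (Sym (tag p)) (tagged p))).
case: find_some => [[b Ms]|[]]; last by exists (existT _ a Ns).
move=> /= /whstepsP[m w1]; case/whstepsP: w => n w2.
have [_ w3] := whn_to_normal w1 w2.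
inversion w3 as [M' e1 e2 e3|n' M' N'' P' st' w'' e1 e2 e3]; subst;
  last by case: (apps_Sym_normal st').
have [eab eNs] := apps_Sym_inj e3.
(* The argument tuples have types indexed by the symbol, so the symbols are identified before the
   tuples. *)
by case: a / eab Ns eNs {w2 w3 e3} => Ns /val_inj ->.
Qed.

Lemma BT_bot M :
  (forall a (Ns : (arity a).-tuple (tm S)), ~ whsteps M (apps (Sym a) Ns)) ->
  BT M = TBot S void.
Proof.
move=> noM; rewrite BTE; have := find_someP
  (fun p : {a : symbol S & (arity a).-tuple (tm S)} =>
     whsteps M (apps (Sym (tag p)) (tagged p))).
by case: find_some => // -[a Ns] /noM.
Qed.

Lemma tree_eq_refl X (t : tree S X) : tree_eq t t.
Proof. by move: t; cofix IH; case=> [|x|a ts]; constructor. Qed.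

Lemma tree_eq_inv X (t u : tree S X) : tree_eq t u ->
  match u with
  | TBot => t = TBot S X
  | TLeaf x => t = TLeaf S x
  | TNode a us => exists2 ts, t = TNode ts & forall i, tree_eq (ts i) (us i)
  end.
Proof. by case=> // a ts us e; exists ts. Qed.

Lemma tree_eq_trans X (t u v : tree S X) : tree_eq t u -> tree_eq u v -> tree_eq t v.
Proof.
move: t u v; cofix IH => t u v e1 e2.
case: e2 e1 => [|x|a us vs e2] /tree_eq_inv.
- by move->; constructor.
- by move->; constructor.
- by case=> ts -> e1; constructor=> i; apply: IH (e1 i) (e2 i).
Qed.

(** Matching condition for a bisimulation in which a pair may also be closed by a known [tree_eq],
    as for leaves, divergence and the parameter child of an operation. *)
Inductive tree_step X (R : tree S X -> tree S X -> Prop) : tree S X -> tree S X -> Prop :=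
| tree_step_eq t u : tree_eq t u -> tree_step R t u
| tree_step_node a (ts us : 'I_(arity a) -> tree S X) :
    (forall i, R (ts i) (us i) \/ tree_eq (ts i) (us i)) ->
    tree_step R (TNode ts) (TNode us).

Lemma tree_eq_coind X (R : tree S X -> tree S X -> Prop) :
  (forall t u, R t u -> tree_step R t u) -> forall t u, R t u -> tree_eq t u.
Proof.
move=> R_step; cofix IH => t u /R_step[{}t {}u //|a ts us Rtsus].
by constructor=> i; case: (Rtsus i) => [/IH|].
Qed.

(** Both terms reach the same symbol-headed spine or neither does: one direction is transitivity,
    the other determinism. *)
Lemma BT_whsteps M N : whsteps M N -> BT M = BT N.
Proof.
move=> w; case: (excluded_middle_informative
  (exists a (Ns : (arity a).-tuple (tm S)), whsteps N (apps (Sym a) Ns))).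
  case=> a [Ns wN]; rewrite (BT_node wN); apply: BT_node.
  case/whstepsP: w => m w; case/whstepsP: wN => n wN.
  by apply/whstepsP; exists (m + n); apply: whn_trans w wN.
move=> noN; rewrite !BT_bot // => a Ns wM; apply: noN; exists a, Ns => //.
case/whstepsP: w => m w; case/whstepsP: wM => n wM.
by apply/whstepsP; exists (n - m); apply: (whn_to_normal w wM).2.
Qed.

(** Weak head reduction never acts inside arguments, so after an operation leaves a [let] its
    branches still have to push the continuation inwards. Hence the orientation: the arguments of
    the second term reduce to those of the first. *)
Inductive args_expand : tm S -> tm S -> Prop :=
| args_expand_refl M : args_expand M M
| args_expand_node a (Ns Ms : (arity a).-tuple (tm S)) :
    (forall i, whsteps (tnth Ms i) (tnth Ns i)) ->
    args_expand (apps (Sym a) Ns) (apps (Sym a) Ms).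

Lemma BT_args_expand M N : args_expand M N -> tree_eq (BT M) (BT N).
Proof.
case=> [P|a Ns Ms e]; first exact: tree_eq_refl.
rewrite (@BT_node _ a Ns); last by constructor.
rewrite (@BT_node _ a Ms); last by constructor.
by constructor=> i; rewrite (BT_whsteps (e i)); apply: tree_eq_refl.
Qed.

(** Each beta step discards one argument and lowers the shift of the body by one. *)
Lemma apps_iter_Lam_const k N Ns :
  size Ns = k -> whn k (apps (iter k (@Lam S) (ren (addn k) N)) Ns) N.
Proof.
elim: k Ns => [|k IH] [|N1 Ns] //= => [_|[eNs]].
  by rewrite ren_as_subst subst_Var; constructor.
rewrite -add1n; apply: whn_trans (IH _ eNs); apply: whn_apps.
apply: whnS (whstep_beta _ _) _; rewrite subst_iter_Lam subst_ren.
rewrite [in X in whn _ X _](_ : subst _ N = ren (addn k) N); first by constructor.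
by rewrite ren_as_subst; apply: subst_ext => x; rewrite /= add1n addSnnS iter_up_add.
Qed.

(** Indices count abstractions from the inside, so [m] denotes the argument at position [k - 1 - m].
    This is below [size Ns], so the default [Y] is never returned. *)
Lemma apps_iter_Lam_Var k m Ns :
  size Ns = k -> m < k ->
  whn k (apps (iter k (@Lam S) (Var S m)) Ns) (nth (Y S) Ns (k.-1 - m)).
Proof.
elim: k Ns => [|k IH] [|N1 Ns] //= [eNs] lt_mk.
rewrite -add1n; apply: (@whn_trans 1 _ _
  (apps (iter k (@Lam S) (iter k (@up S) (inst N1) m)) Ns)).
  apply: whn_apps; apply: whnS (whstep_beta _ _) _.
  by rewrite subst_iter_Lam; constructor.
(* Index [k] belongs to the outermost abstraction and has just become the first argument; a smaller
   index is still a bound variable. *)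
have [lt_mk'|le_km] := ltnP m k; last first.
  have -> : m = k + 0 by rewrite addn0; apply/eqP; rewrite eqn_leq -ltnS lt_mk.
  by rewrite iter_up_add addn0 subnn; apply: apps_iter_Lam_const.
rewrite iter_up_lt //; have := IH _ eNs lt_mk'.
by case: k {IH eNs lt_mk} lt_mk' => // k lt_mk'; rewrite subSn.
Qed.

End WeakHead.

(** * Simulation of source reduction by the translation *)

Section Simulation.

Variable S : signature.
Implicit Types (C B : computation S) (K : tm S).

(** Substituting [K] for the continuation variable cancels the renaming of the subterms past it, so
    one beta step suffices. The other computation formers follow the same pattern. *)
Lemma cps_ret_step V K :
  whstep (App (cps_comp (@CRet S V)) K) (App K (cps_val V)).
Proof.
rewrite -[cps_val V in X in whstep _ X](subst_inst_ren K).
exact: whstep_beta.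
Qed.

Lemma cps_app_step V W K :
  whstep (App (cps_comp (@CApp S V W)) K) (apps (cps_val V) [:: cps_val W; K]).
Proof.
rewrite -[cps_val V in X in whstep _ X](subst_inst_ren K).
rewrite -[cps_val W in X in whstep _ X](subst_inst_ren K).
exact: whstep_beta.
Qed.

Lemma cps_let_step C B K :
  whstep (App (cps_comp (CLet C B)) K)
    (App (cps_comp C) (Lam (App (cps_comp B) (ren succn K)))).
Proof.
have -> : App (cps_comp C) (Lam (App (cps_comp B) (ren succn K))) =
  subst (inst K) (App (ren succn (cps_comp C))
               (Lam (App (ren (up_ren succn) (cps_comp B)) (Var S 1)))).
  rewrite /= subst_inst_ren subst_ren; congr (App _ (Lam (App _ _))).
  by rewrite -[LHS]subst_Var; apply: subst_ext => -[|x].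
exact: whstep_beta.
Qed.

Lemma cps_case_step k V (Cs : 'I_k -> computation S) K :
  whstep (App (cps_comp (CCase V Cs)) K)
    (apps (cps_val V) [seq App (cps_comp (Cs i)) K | i <- enum 'I_k]).
Proof.
have -> : apps (cps_val V) [seq App (cps_comp (Cs i)) K | i <- enum 'I_k] =
  subst (inst K) (apps (ren succn (cps_val V))
     [seq App (ren succn (cps_comp (Cs i))) (Var S 0) | i <- enum 'I_k]).
  rewrite subst_apps subst_inst_ren -map_comp; congr apps.
  by apply: eq_map => i /=; rewrite subst_inst_ren.
exact: whstep_beta.
Qed.

(** The numeral is substituted in the source, before translation, so that the branches match the
    children of [ET]. *)
Definition op_args (o : op S) (V : value S) (C : computation S) (K : tm S) :
    (arity (SOp o)).-tuple (tm S) :=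
  cons_tuple (cps_val V)
    (map_tuple (fun i => App (cps_comp (subst_comp (inst_val (VEnum S i)) C)) K)
               (ord_tuple (op_ar o))).

Lemma cps_op_step o V C K :
  whstep (App (cps_comp (COp o V C)) K) (apps (Sym (SOp o)) (op_args o V C K)).
Proof.
have -> : apps (Sym (SOp o)) (op_args o V C K) =
  subst (inst K) (apps (Sym (SOp o))
             (ren succn (cps_val V) ::
              [seq App (ren succn (subst (inst (cps_enum S i)) (cps_comp C)))
                       (Var S 0)
              | i <- enum 'I_(op_ar o)])).
  rewrite subst_apps /= subst_inst_ren -map_comp; congr (apps _ (_ :: _)).
  by apply: eq_map => i /=; rewrite cps_inst_comp subst_inst_ren.
exact: whstep_beta.
Qed.

Lemma tnth_op_args0 o V C K : tnth (op_args o V C K) ord0 = cps_val V.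
Proof. exact: tnth0. Qed.

Lemma tnth_op_argsS o V C K i :
  tnth (op_args o V C K) (lift ord0 i) =
  App (cps_comp (subst_comp (inst_val (VEnum S i)) C)) K.
Proof. by rewrite tnthS tnth_map tnth_ord_tuple. Qed.

Lemma cps_enum_select k (n : 'I_k) (F : 'I_k -> tm S) :
  whn k (apps (cps_enum S n) [seq F i | i <- enum 'I_k]) (F n).
Proof.
have := @apps_iter_Lam_Var S k (rev_ord n) [seq F i | i <- enum 'I_k].
rewrite size_map size_enum_ord => /(_ erefl (ltn_ord _)).
rewrite (nth_map n) ?size_enum_ord; last first.
  by case: k n F => [[]|k n F] //=; rewrite ltnS leq_subr.
(* The reversal in [cps_enum] undoes the inside-out counting: [k - 1 - (k - 1 - n) = n]. *)
suff -> : nth n (enum 'I_k) (k.-1 - rev_ord n) = n by [].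
apply: val_inj; rewrite /= nth_enum_ord.
  by case: k n F => [[]|k n F] //=; rewrite subSS subKn // -ltnS.
by case: k n F => [[]|k n F] //=; rewrite ltnS leq_subr.
Qed.

(* The strict decrease [n < m] is what makes divergence of [C] entail
   divergence of its translation. *)
Lemma step_simulation C C' : step C C' -> forall K, exists P P' m n,
  [/\ n < m, whn m (App (cps_comp C) K) P, whn n (App (cps_comp C') K) P'
    & args_expand P P'].
Proof.
elim=> {C C'} [C V|V W|V B|k n Cs|C C' B _ IH|o V C B] K.
- exists (App (cps_comp (subst_comp (inst_val V) C)) K),
         (App (cps_comp (subst_comp (inst_val V) C)) K), 2, 0.
  split=> //; try by constructor.
  apply: whnS (cps_app_step _ _ _) _; rewrite cps_inst_comp.
  by apply: whnS (whn0 _); do 2 constructor.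
- set P := apps (cps_val (subst_val (inst_val (VFix V)) V)) [:: cps_val W; K].
  (* The common reduct is the unrolled fixpoint: application, [Y] and beta steps on one side, the
     application step alone on the other. *)
  exists P, P, 3, 1; split=> //; try by constructor.
    apply: whnS (cps_app_step _ _ _) _; rewrite /P cps_inst_val.
    apply: (@whn_apps _ 2 _ _ [:: cps_val W; K]).
    apply: whnS; first exact: whstep_Y.
    by apply: whnS (whn0 _); constructor.
  by apply: whnS (whn0 _); apply: cps_app_step.
- exists (App (cps_comp (subst_comp (inst_val V) B)) K),
         (App (cps_comp (subst_comp (inst_val V) B)) K), 3, 0.
  split=> //; try by constructor.
  apply: whnS (cps_let_step _ _ _) _; apply: whnS (cps_ret_step _ _) _.
  rewrite cps_inst_comp -[K in X in whn _ _ X](subst_inst_ren (cps_val V)).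
  by apply: whnS (whn0 _); apply: whstep_beta.
- exists (App (cps_comp (Cs n)) K), (App (cps_comp (Cs n)) K), k.+1, 0.
  split=> //; try by constructor.
  apply: whnS (cps_case_step _ _ _) _.
  exact: (cps_enum_select n (fun i => App (cps_comp (Cs i)) K)).
(* The frame of the [let] is absorbed into the continuation, which is why the claim ranges over all
   [K]. *)
- have [P [P' [m [n [lt_nm wC wC' PP']]]]] := IH (Lam (App (cps_comp B) (ren succn K))).
  exists P, P', m.+1, n.+1.
  by split=> //; [apply: whnS wC | apply: whnS wC']; apply: cps_let_step.
- set K' := Lam (App (cps_comp B) (ren succn K)).
  pose D := CLet C (ren_comp (up_ren succn) B).
  exists (apps (Sym (SOp o)) (op_args o V C K')),
         (apps (Sym (SOp o)) (op_args o V D K)), 2, 1.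
  split=> //.
  + apply: whnS (cps_let_step _ _ _) _.
    by apply: whnS (whn0 _); apply: cps_op_step.
  + by apply: whnS (whn0 _); apply: cps_op_step.
  + constructor=> i; case: (unliftP ord0 i) => [j ->|->]; last first.
      by rewrite !tnth_op_args0; constructor.
    rewrite !tnth_op_argsS; apply/whstepsP; exists 1.
    apply: whnS (cps_let_step _ _ _) _.
    (* [B] was renamed past the variable of the operation, and instantiating that variable by the
       numeral undoes this. *)
    rewrite [X in App X (ren succn K)](_ : _ = cps_comp B); first by constructor.
    rewrite (cps_subst S).2 (cps_ren S).2 subst_ren -[RHS]subst_Var.
    by apply: subst_ext => -[|x].
Qed.

(** Strong induction on the distance [l] to the head symbol: unless [C] is a result, progress gives
    a source step, and this shortens the distance. *)
Lemma convergence l C T K a (Ns : (arity a).-tuple (tm S)) :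
  has_ty_comp [::] C T -> whn l (App (cps_comp C) K) (apps (Sym a) Ns) ->
  exists r, steps C (comp_of_result r).
Proof.
elim/ltn_ind: l C a Ns => l IH C a Ns tyC w.
have [[r ->]|[C' st]] := progress tyC; first by exists r; constructor.
have [P [P' [m [n [lt_nm wP wP' PP']]]]] := step_simulation st K.
have [le_ml wPN] := whn_to_normal wP w.
suff [l' [b [Ms [lt_l' w']]]] : exists l' b (Ms : (arity b).-tuple (tm S)),
    l' < l /\ whn l' (App (cps_comp C') K) (apps (Sym b) Ms).
  have [r str] := IH _ lt_l' _ _ _ (preservation st tyC) w'.
  by exists r; econstructor; eauto.
(* With a shared reduct, [n < m] steps replace the first [m] of the [l] steps; otherwise [C']
   already shows a symbol after [n < m <= l] steps. *)
case: PP' wP' wPN {wP} => [Q|b Ns' Ms _] wQ wQN.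
  exists (n + (l - m)), a, Ns; split; last exact: whn_trans wQ wQN.
  by rewrite -{2}(subnKC le_ml) ltn_add2r.
by exists n, b, Ms; split=> //; apply: leq_trans lt_nm le_ml.
Qed.

Lemma BT_steps C C' K : steps C C' ->
  tree_eq (BT (App (cps_comp C) K)) (BT (App (cps_comp C') K)).
Proof.
elim=> [D|C1 C2 C3 st _ IH]; first exact: tree_eq_refl.
apply: tree_eq_trans IH.
have [P [P' [m [n [_ w w' PP']]]]] := step_simulation st K.
rewrite (BT_whsteps (N := P)); last by apply/whstepsP; exists m.
rewrite (BT_whsteps (N := P') (M := App _ _)); last by apply/whstepsP; exists n.
exact: BT_args_expand.
Qed.

Lemma ETE C : ET C =
  match find_some (fun r => steps C (comp_of_result r)) with
  | None => TBot S (value S)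
  | Some (RRet V) => TLeaf S V
  | Some (ROp o v C') =>
      @TNode S (value S) (SOp o) (fun i : 'I_(op_ar o).+1 =>
        match unlift ord0 i with
        | None => const_tree (value S) v
        | Some j => ET (subst_comp (inst_val (VEnum S j)) C')
        end)
  end.
Proof.
rewrite [LHS]tree_unfold /=.
by case: find_some => [[V|o v C']|].
Qed.

Lemma graftE X Z (t : tree S X) (f : X -> tree S Z) : graft t f =
  match t with
  | TBot => TBot S Z
  | TLeaf x => f x
  | TNode a ts => TNode (fun i => graft (ts i) f)
  end.
Proof. by rewrite [LHS]tree_unfold; case: t => //= x; case: (f x). Qed.

End Simulation.

(** * Coinduction relating Böhm trees to effect trees *)

Theorem theorem5p5 (S : signature) (C : computation S) (T : ty S)
  (hC : has_ty_comp [::] C T)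
  (c : tm S) (hc : has_lty [::] c (LArr (cps_ty T) LO)) :
  tree_eq (BT (App (cps_comp C) c))
          (graft (ET C) (fun V => BT (App c (cps_val V)))).
Proof.
(* The left tree is fixed only up to [tree_eq], since [BT_steps] gives bisimilarity and not
   equality. Typing is kept in [R] because [convergence] relies on it. *)
pose R t u := exists2 C, has_ty_comp [::] C T &
  tree_eq t (BT (App (cps_comp C) c)) /\
  u = graft (ET C) (fun V => BT (App c (cps_val V))).
apply: (@tree_eq_coind _ _ R); last by exists C => //; split=> //; apply: tree_eq_refl.
move=> {C hC} t u [C hC [tC ->]].
rewrite graftE ETE; have := find_someP (fun r => steps C (comp_of_result r)).
case: find_some => [[V|o v D] /= st|noR].
- apply: tree_step_eq; apply: tree_eq_trans tC _.
  apply: tree_eq_trans (BT_steps c st) _.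
  rewrite (BT_whsteps (N := App c (cps_val V))); first exact: tree_eq_refl.
  by apply/whstepsP; exists 1; apply: whnS (whn0 _); apply: cps_ret_step.
- have [_ tyD] := comp_typing_inv (steps_preservation st hC).
  have /tree_eq_inv := tree_eq_trans tC (BT_steps c st).
  rewrite (BT_node (Ns := op_args o (VConst v) D c)); last first.
    by apply/whstepsP; exists 1; apply: whnS (whn0 _); apply: cps_op_step.
  case=> ts -> ets; apply: tree_step_node => i; have := ets i.
  (* A branch child stays in [R] with the numeral substituted; the parameter child is closed
     directly, both sides being the same childless constant node. *)
  case: unliftP => [j ->|->].
    rewrite tnth_op_argsS => etj; left.
    exists (subst_comp (inst_val (VEnum S j)) D) => //.
    by apply: (subst_typing S).2 tyD _ _ (inst_typing _); constructor.
  rewrite tnth_op_args0 => et0; right; apply: tree_eq_trans et0 _.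
  rewrite (BT_node (a := SConst v) (Ns := nil_tuple _)); last by constructor.
  by rewrite graftE; constructor=> -[].
- apply: tree_step_eq; apply: tree_eq_trans tC _.
  rewrite BT_bot; first by constructor.
  (* A head symbol of the translation would force [C] to reach a result. *)
  by move=> a Ns /whstepsP[l w]; apply: noR; apply: convergence hC w.
Qed.
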